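(* Let $n\ge 2$, let $B\in \mathfrak{gl}(n-1,\mathbb{H})\subset \mathfrak{gl}(4n-4,\mathbb{R})$ be a nilpotent matrix, let $v_0\in\mathbb{R}^{4n-4}$, put $v_\alpha=J_\alpha v_0$ for $\alpha=1,2,3$, and let $$A=\begin{bmatrix} 0_3 & 0\\ V & B\end{bmatrix}\in\mathfrak{gl}(4n-1,\mathbb{R}),$$ where $V$ is the $(4n-4)\times 3$ matrix with columns $v_1,v_2,v_3$. Assume $A\ne 0$. Consider the (hypercomplex almost abelian) Lie algebra $\mathfrak{g}_A=\mathbb{R}e_0\ltimes_A\mathbb{R}^{4n-1}$. (i) If $B=0$, then $\mathfrak{g}_A$ is $2$-step nilpotent and isomorphic to $\mathfrak{g}_{N(n-1)}$. (ii) If $B\neq 0$ with $\Sigma(B)=(r,m_1,\dots,m_r,p_1,\dots,p_r,s)$, where $r\ge 1$, $m_1>\dots>m_r\ge 2$, $s\ge 0$, $p_k>0$, then there exists a unique integer $\ell$ with $0\le \ell\le r+1-\delta_{s,0}$ such that $\mathfrak{g}_A$ is isomorphic to $\mathfrak{g}_{A_\ell}$, where the matrices $A_0,A_1,\dots,A_{r+1}$ are those associated with the tuple $\Sigma(B)$ ($A_{r+1}$ being defined only if $s>0$). The Lie algebra $\mathfrak{g}_{A_1}$ is $(m_1+1)$-step nilpotent and $\mathfrak{g}_{A_\ell}$ is $m_1$-step nilpotent for $\ell\ne 1$. Moreover, for such a tuple, the Lie algebras $\mathfrak{g}_{N(n-1)},\mathfrak{g}_{A_0},\dots,\mathfrak{g}_{A_{r+1}}$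 are pairwise non-isomorphic (with $\mathfrak{g}_{A_{r+1}}$ omitted if $s=0$).
   Context: For $M\in\mathfrak{gl}(d,\mathbb{R})$, $\mathfrak{g}_M=\mathbb{R}e_0\ltimes_M\mathbb{R}^d$ is the Lie algebra with $\mathbb{R}^d$ an abelian ideal and $[e_0,v]=Mv$ for $v\in\mathbb{R}^d$. $\delta_{s,0}$ is the Kronecker delta. For matrices, $M_1\oplus M_2$ denotes the block diagonal matrix, $M^{\oplus p}$ is $M\oplus\dots\oplus M$ ($p$ copies), and $0_k$, $I_k$ are the zero and identity $k\times k$ matrices. Hypercomplex structure on $\mathbb{R}^{4q}$ ($q=n-1$): in $q\times q$ blocks, acting on $(a,b,c,d)\in(\mathbb{R}^q)^4$, $J_1(a,b,c,d)=(-b,a,-d,c)$, $J_2(a,b,c,d)=(-c,d,a,-b)$, $J_3=J_1J_2$. $\mathfrak{gl}(q,\mathbb{H})=\{T\in\mathfrak{gl}(4q,\mathbb{R}): TJ_\alpha=J_\alpha T,\ \alpha=1,2,3\}$; its elements are the matrices $$B=\begin{bmatrix} X&-Y&-Z&-W\\ Y&X&W&-Z\\ Z&-W&X&Y\\ W&Z&-Y&X\end{bmatrix},\quad X,Y,Z,W\in\mathfrak{gl}(q,\mathbb{R}),$$ and $\sigma:\mathfrak{gl}(q,\mathbb{H})\to M_q(\mathbb{H})$, $\sigma(B)=X+iY-jZ+kW$, is an isomorphism of unital $\mathbb{R}$-algebras. Let $J_m\in M_m(\mathbb{H})$ be the nilpotent Jordan block with ones on the subdiagonal and zeros elsewhere.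 For $B\neq0$ nilpotent, $\Sigma(B)=(r,m_1,\dots,m_r,p_1,\dots,p_r,s)$ is the tuple ($r\geq 1$, $m_1>\dots>m_r\ge2$, $p_k>0$, $s\ge0$) such that $\sigma(B)$ is conjugate in $M_{q}(\mathbb{H})$ to $J_{m_1}^{\oplus p_1}\oplus\dots\oplus J_{m_r}^{\oplus p_r}\oplus 0_s$; it is well defined and $n-1=\sum_{i=1}^r m_ip_i+s$. Let $U=\begin{bmatrix}0&0&0\\1&0&0\\0&1&0\\0&0&1\end{bmatrix}$, and let $\mathbb{J}_m\in M_{4m}(\mathbb{R})$ be the matrix of $4\times4$ blocks with $I_4$ on the block subdiagonal and $0_4$ elsewhere. Given a tuple $(r,m_1,\dots,m_r,p_1,\dots,p_r,s)$ put $$N_\ell=\begin{bmatrix}0_3&0\\ \begin{smallmatrix}U\\0\end{smallmatrix}&\mathbb{J}_{m_\ell}\end{bmatrix}\oplus(\mathbb{J}_{m_\ell})^{\oplus(p_\ell-1)}\ (1\le\ell\le r),\qquad N(s)=\begin{bmatrix}0_3&0\\ \begin{smallmatrix}U\\0\end{smallmatrix}&0_{4s}\end{bmatrix}\ (s>0),$$ where $\begin{smallmatrix}U\\0\end{smallmatrix}$ is $U$ on top of a zero matrix with $4(m_\ell-1)$ rows, respectively $4(s-1)$ rows, and $$A_0=0_3\oplus(\mathbb{J}_{m_1})^{\oplus p_1}\oplus\dots\oplus(\mathbb{J}_{m_r})^{\oplus p_r}\oplus0_{4s},$$ $$A_\ell=\bigoplus_{i=1}^{\ell-1}(\mathbb{J}_{m_i})^{\oplus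 p_i}\oplus N_\ell\oplus\bigoplus_{i=\ell+1}^{r}(\mathbb{J}_{m_i})^{\oplus p_i}\oplus0_{4s}\quad(1\le\ell\le r),$$ $$A_{r+1}=(\mathbb{J}_{m_1})^{\oplus p_1}\oplus\dots\oplus(\mathbb{J}_{m_r})^{\oplus p_r}\oplus N(s)\quad(\text{only for }s>0).$$ *)

(* Defs.v *)
From HB Require Import structures.
From mathcomp Require Import all_boot all_order all_algebra.
From mathcomp Require Import ring.
From mathcomp Require Export reals.

Set Implicit Arguments.
Unset Strict Implicit.
Unset Printing Implicit Defensive.

Import GRing.Theory.
Local Open Scope ring_scope.

(** * Lie algebras *)

HB.mixin Record Lmodule_isLie (R : comNzRingType) L of GRing.Lmodule R L := {
  bracket : L -> L -> L;
  bracket_linearl : forall z, linear (bracket^~ z);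
  bracket_linearr : forall x, linear (bracket x);
  bracketxx : forall x, bracket x x = 0;
  bracket_jacobi : forall x y z,
    bracket x (bracket y z) + bracket y (bracket z x) + bracket z (bracket x y)
      = 0
}.

#[short(type="lieType")]
HB.structure Definition Lie (R : comNzRingType) :=
  { L of GRing.Lmodule R L & Lmodule_isLie R L }.

Definition lie_isom (R : comNzRingType) (L L' : lieType R) : Prop :=
  exists f : {linear L -> L'},
    bijective f /\ forall x y, f (bracket x y) = bracket (f x) (f y).

(* Lower central series, indexed from 0: [lcs 0] is the whole algebra and
   [lcs k.+1] is the linear span of the brackets [x, y] with y in [lcs k]. *)
Fixpoint lcs (R : comNzRingType) (L : lieType R) (k : nat) (z : L) : Prop :=
  if k is k'.+1 then
    exists (N : nat) (c : 'I_N -> R) (x y : 'I_N -> L),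
      (forall i, lcs k' (y i)) /\ z = \sum_(i < N) c i *: bracket (x i) (y i)
  else True.

Definition step_nilpotent (R : comNzRingType) (L : lieType R) (k : nat) : Prop :=
  (forall z : L, lcs k z -> z = 0) /\
  (forall j, (j < k)%N -> ~ (forall z : L, lcs j z -> z = 0)).

(* The carrier of R e_0 |x_M R^d: the pair (a, v) stands for a e_0 + v. *)
Definition almost_abelian (R : comNzRingType) (d : nat) (M : 'M[R]_d) : Type :=
  (R^o * 'cV[R]_d)%type.

Section AlmostAbelian.
Variables (R : comNzRingType) (d : nat) (M : 'M[R]_d).

HB.instance Definition _ :=
  GRing.Lmodule.copy (almost_abelian M) (R^o * 'cV[R]_d)%type.

(* [a e_0 + v, b e_0 + w] = a M w - b M v *)
Definition aa_bracket (x y : almost_abelian M) : almost_abelian M :=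
  (0, x.1 *: (M *m y.2) - y.1 *: (M *m x.2)).

Fact aa_bracketxx x : aa_bracket x x = 0.
Proof. by rewrite /aa_bracket subrr. Qed.

Fact aa_bracket_linearr x : linear (aa_bracket x).
Proof.
move=> a y z; congr pair => /=; first by rewrite scaler0 addr0.
rewrite mulmxDr -scalemxAr.
by apply/colP => i; rewrite !mxE /GRing.scale /=; ring.
Qed.

Fact aa_bracketC x y : aa_bracket x y = - aa_bracket y x.
Proof. by congr pair; rewrite /= ?oppr0 ?opprB. Qed.

Fact aa_bracket_linearl z : linear (aa_bracket^~ z).
Proof.
by move=> a x y; rewrite aa_bracketC aa_bracket_linearr opprD -scalerN -!aa_bracketC.
Qed.

Fact aa_bracket_jacobi x y z :
  aa_bracket x (aa_bracket y z) + aa_bracket y (aa_bracket z x)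
    + aa_bracket z (aa_bracket x y) = 0.
Proof.
congr pair => /=; first by rewrite !addr0.
rewrite !scale0r !subr0 !mulmxBr -!scalemxAr.
apply/colP => i; rewrite !mxE; ring.
Qed.

HB.instance Definition _ := Lmodule_isLie.Build R (almost_abelian M)
  aa_bracket_linearl aa_bracket_linearr aa_bracketxx aa_bracket_jacobi.

End AlmostAbelian.

Notation "''g_' M" := (almost_abelian M : lieType _)
  (at level 8, M at level 2, format "''g_' M") : ring_scope.

(** * Quaternions *)

(* [Quat a b c d] is a + b i + c j + d k. *)
Record quat (R : Type) : Type := Quat { qre : R; qi : R; qj : R; qk : R }.

Definition quat_to_prod (R : Type) (x : quat R) : R * R * R * R :=
  (qre x, qi x, qj x, qk x).
Definition prod_to_quat (R : Type) (x : R * R * R * R) : quat R :=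
  let: (a, b, c, d) := x in Quat a b c d.
Fact quat_to_prodK (R : Type) : cancel (@quat_to_prod R) (@prod_to_quat R).
Proof. by case. Qed.

HB.instance Definition _ (R : choiceType) :=
  Choice.copy (quat R) (can_type (@quat_to_prodK R)).

Section QuatRing.
Variable R : comNzRingType.
Implicit Types x y z : quat R.

Definition quat_zero : quat R := Quat 0 0 0 0.
Definition quat_one : quat R := Quat 1 0 0 0.
Definition quat_opp x : quat R := Quat (- qre x) (- qi x) (- qj x) (- qk x).
Definition quat_add x y : quat R :=
  Quat (qre x + qre y) (qi x + qi y) (qj x + qj y) (qk x + qk y).
Definition quat_mul x y : quat R :=
  Quat (qre x * qre y - qi x * qi y - qj x * qj y - qk x * qk y)
       (qre x * qi y + qi x * qre y + qj x * qk y - qk x * qj y)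
       (qre x * qj y - qi x * qk y + qj x * qre y + qk x * qi y)
       (qre x * qk y + qi x * qj y - qj x * qi y + qk x * qre y).

Fact quat_addA : associative quat_add.
Proof. by move=> x y z; congr Quat; rewrite /= addrA. Qed.
Fact quat_addC : commutative quat_add.
Proof. by move=> x y; congr Quat; rewrite /= addrC. Qed.
Fact quat_add0 : left_id quat_zero quat_add.
Proof. by case=> a b c d; congr Quat; rewrite /= add0r. Qed.
Fact quat_addN : left_inverse quat_zero quat_opp quat_add.
Proof. by case=> a b c d; congr Quat; rewrite /= addNr. Qed.

HB.instance Definition _ := GRing.isZmodule.Build (quat R)
  quat_addA quat_addC quat_add0 quat_addN.

Fact quat_mulA : associative quat_mul.
Proof. by move=> x y z; congr Quat => /=; ring. Qed.
Fact quat_mul1l : left_id quat_one quat_mul.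
Proof. by case=> a b c d; congr Quat => /=; ring. Qed.
Fact quat_mul1r : right_id quat_one quat_mul.
Proof. by case=> a b c d; congr Quat => /=; ring. Qed.
Fact quat_mulDl : left_distributive quat_mul +%R.
Proof. by move=> x y z; congr Quat => /=; ring. Qed.
Fact quat_mulDr : right_distributive quat_mul +%R.
Proof. by move=> x y z; congr Quat => /=; ring. Qed.
Fact quat_one_neq0 : quat_one != 0.
Proof. by apply/eqP => -[] /eqP; rewrite oner_eq0. Qed.

HB.instance Definition _ := GRing.Zmodule_isNzRing.Build (quat R)
  quat_mulA quat_mul1l quat_mul1r quat_mulDl quat_mulDr quat_one_neq0.

End QuatRing.

(** * The hypercomplex structure and gl(q, H) *)

(* R^(4q) is indexed by (q + q) + (q + q), following the blocks (a, b, c, d). *)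
Notation hdim q := ((q + q) + (q + q))%N.

Section Hypercomplex.
Variables (R : comNzRingType) (q : nat).

Definition hJ1 : 'M[R]_(hdim q) :=
  block_mx (block_mx 0 (- 1%:M) 1%:M 0) 0
           0 (block_mx 0 (- 1%:M) 1%:M 0).
Definition hJ2 : 'M[R]_(hdim q) :=
  block_mx 0 (block_mx (- 1%:M) 0 0 1%:M)
           (block_mx 1%:M 0 0 (- 1%:M)) 0.
Definition hJ3 : 'M[R]_(hdim q) := hJ1 *m hJ2.

Lemma hJ1E (a b c d : 'cV[R]_q) :
  hJ1 *m col_mx (col_mx a b) (col_mx c d)
    = col_mx (col_mx (- b) a) (col_mx (- d) c).
Proof.
by rewrite !mul_block_col !mul0mx !mulNmx !mul1mx !add0r !addr0.
Qed.

Lemma hJ2E (a b c d : 'cV[R]_q) :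
  hJ2 *m col_mx (col_mx a b) (col_mx c d)
    = col_mx (col_mx (- c) d) (col_mx a (- b)).
Proof.
by rewrite !mul_block_col !mul0mx !mulNmx !mul1mx !add0r !addr0.
Qed.

Definition in_glH (T : 'M[R]_(hdim q)) : Prop :=
  [/\ T *m hJ1 = hJ1 *m T, T *m hJ2 = hJ2 *m T & T *m hJ3 = hJ3 *m T].

Lemma in_glHP (T : 'M[R]_(hdim q)) :
  in_glH T <-> exists X Y Z W : 'M[R]_q,
    T = block_mx (block_mx X (- Y) Y X) (block_mx (- Z) (- W) W (- Z))
                 (block_mx Z (- W) W Z) (block_mx X Y (- Y) X).
Proof.
pose E := (mulmx_block, mul0mx, mulmx0, mulNmx, mulmxN, mul1mx, mulmx1,
           addr0, add0r, oppr0, opprK).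
split=> [[+ + _] | [X [Y [Z [W ->]]]]]; last first.
  set T' := block_mx _ _ _ _.
  have H1 : T' *m hJ1 = hJ1 *m T' by rewrite /T' /hJ1 !E.
  have H2 : T' *m hJ2 = hJ2 *m T' by rewrite /T' /hJ2 !E.
  by split=> //; rewrite /hJ3 mulmxA H1 -!mulmxA H2.
rewrite -[T]submxK -[ulsubmx T]submxK -[ursubmx T]submxK -[dlsubmx T]submxK
  -[drsubmx T]submxK.
move: (ulsubmx (ulsubmx T)) => X; move: (dlsubmx (ulsubmx T)) => Y.
move: (ulsubmx (dlsubmx T)) => Z; move: (dlsubmx (dlsubmx T)) => W.
rewrite /hJ1 /hJ2 !E.
move=> /eq_block_mx[/eq_block_mx[-> _ -> _] /eq_block_mx[-> _ -> _]
                    /eq_block_mx[-> _ -> _] /eq_block_mx[-> _ -> _]].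
move=> /eq_block_mx[/eq_block_mx[-> _ -> _] _ /eq_block_mx[-> _ -> _] _].
by exists X, Y, Z, W; rewrite opprK.
Qed.

(* The first block column of an element of gl(q, H) is (X, Y, Z, W), and sigma
   sends that element to X + i Y - j Z + k W. *)
Definition sigmaH (B : 'M[R]_(hdim q)) : 'M[quat R]_q :=
  let X := ulsubmx (ulsubmx B) in let Y := dlsubmx (ulsubmx B) in
  let Z := ulsubmx (dlsubmx B) in let W := dlsubmx (dlsubmx B) in
  \matrix_(i, j) Quat (X i j) (Y i j) (- Z i j) (W i j).

Definition hyperA (B : 'M[R]_(hdim q)) (v0 : 'cV[R]_(hdim q)) :
    'M[R]_(3 + hdim q) :=
  block_mx (0 : 'M_3) 0
    (row_mx (hJ1 *m v0) (row_mx (hJ2 *m v0) (hJ3 *m v0)) : 'M_(hdim q, 3)) B.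

End Hypercomplex.

(** * Block diagonal matrices and the quaternionic Jordan form *)

Definition dsum (R : nzRingType) (a b : nat) (M1 : 'M[R]_a) (M2 : 'M[R]_b) :
  'M[R]_(a + b) := block_mx M1 0 0 M2.
Notation "M1 (+m) M2" := (dsum M1 M2)
  (at level 50, left associativity) : ring_scope.

Definition dpow (R : nzRingType) (a : nat) (M : 'M[R]_a) (p : nat) :
  'M[R]_(\sum_(i < p) a) := \mxdiag_(i < p) M.
Notation "M ^(+m) p" := (dpow M p)
  (at level 30, right associativity) : ring_scope.

Definition nilJ (R : nzRingType) (m : nat) : 'M[R]_m :=
  \matrix_(i, j) (i == j.+1 :> nat)%:R.

(* In a tuple (r, m_1, .., m_r, p_1, .., p_r, s) the families m and p are
   functions on nat of which only the values at 1, .., r are ever used. *)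
Definition jordan_tuple (q r : nat) (m p : nat -> nat) (s : nat) : Prop :=
  [/\ (1 <= r)%N,
      (forall i j, 1 <= i -> i < j -> j <= r -> m j < m i)%N,
      (forall i, 1 <= i <= r -> 2 <= m i)%N,
      (forall i, 1 <= i <= r -> 0 < p i)%N &
      q = (\sum_(1 <= i < r.+1) m i * p i + s)%N].

Definition jordanH (R : comNzRingType) (r : nat) (m p : nat -> nat) (s : nat) :=
  \mxdiag_(k < r) (nilJ (quat R) (m k.+1) ^(+m) p k.+1)
    (+m) (0 : 'M[quat R]_s).

(* [jordanH R r m p s] has size q only up to a propositional equality, hence the
   rectangular conjugating matrix P and its two-sided inverse P'. *)
Definition is_Sigma (R : comNzRingType) (q : nat) (B : 'M[R]_(hdim q))
    (r : nat) (m p : nat -> nat) (s : nat) : Prop :=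
  jordan_tuple q r m p s /\
  exists (P : 'M[quat R]_(q, _)) (P' : 'M[quat R]_(_, q)),
    [/\ P *m P' = 1%:M, P' *m P = 1%:M &
        sigmaH B = P *m jordanH R r m p s *m P'].

(** * The canonical matrices *)

Section Canonical.
Variable R : comNzRingType.

Definition matU : 'M[R]_(4, 3) :=
  \matrix_(i, j) (i == j.+1 :> nat)%:R.

(* U on top of k - 1 zero blocks of size 4 x 3 *)
Definition topU (k : nat) : 'M[R]_(\sum_(i < k) 4, 3) :=
  \mxcol_(i < k) (if i == 0%N :> nat then matU else 0).

Definition bigJ (m : nat) : 'M[R]_(\sum_(i < m) 4) :=
  \mxblock_(i < m, j < m) (if i == j.+1 :> nat then 1%:M else 0 : 'M[R]_4).

Definition matN (m p : nat) :=
  block_mx (0 : 'M[R]_3) 0 (topU m) (bigJ m) (+m) bigJ m ^(+m) p.-1.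

Definition matNs (s : nat) :=
  block_mx (0 : 'M[R]_3) 0 (topU s) (0 : 'M[R]_(\sum_(i < s) 4)).

Variables (r : nat) (m p : nat -> nat) (s : nat).

(* the direct sum of the (bigJ m_i)^(+ p_i) over a <= i <= b *)
Definition Jsum (a b : nat) :=
  \mxdiag_(k < b.+1 - a) (bigJ (m (a + k)) ^(+m) p (a + k)).

Definition matA0 := (0 : 'M[R]_3) (+m) Jsum 1 r (+m) (0 : 'M[R]_(4 * s)).

Definition matA_mid (l : nat) :=
  Jsum 1 l.-1 (+m) matN (m l) (p l) (+m) Jsum l.+1 r (+m) (0 : 'M[R]_(4 * s)).

Definition matA_last := Jsum 1 r (+m) matNs s.

(* g_{A_l} for 0 <= l <= r, and for l = r + 1 when s > 0. The sizes of the A_l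
   agree only propositionally, so the case analysis is made on Lie algebras. *)
Definition gA (l : nat) : lieType R :=
  if l == 0%N then 'g_ matA0
  else if (l <= r)%N then 'g_ (matA_mid l)
  else 'g_ matA_last.

End Canonical.

(* Main.v *)
Require Import Defs.
From HB Require Import structures.
From mathcomp Require Import all_boot all_order all_algebra.
From mathcomp Require Import ring zify.
From mathcomp Require Import reals.

(** For nilpotent M, the algebra g_M is determined up to isomorphism by the ranks
    of the powers of M: these ranks are the dimensions of the lower central
    series, and conversely nilpotent matrices whose powers have equal ranks are
    similar. So the whole statement is about ranks.

    Since im B^k is a quaternionic subspace, rank A^k is rank B^k when
    B^(k-1) v_0 lies in im B^k, and rank B^k + 3 otherwise. The second case holds
    exactly for k <= t, where t is least with B^t v_0 in im B^(t+1). If t > 0,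
    then ker B meets im B^(t-1) and im B^t in different subspaces, which makes
    the second difference of rank B^k at t nonzero: t is the size of a Jordan
    block of B. The canonical A_l realise precisely these possibilities, as each
    of their Jordan pieces is a shift by 4 of the coordinates. *)

Set Implicit Arguments.
Unset Strict Implicit.
Unset Printing Implicit Defensive.

Import Order.TTheory GRing.Theory Num.Theory.
Local Open Scope ring_scope.

(** * Similarity of nilpotent matrices *)

Section Similarity.
Variable F : fieldType.

(** The transposes of [A] and of [row_mx 1 0] both have all of F^r as row space, so they differ by
    an invertible left factor. *)
Lemma row_free_factor (r e : nat) (A : 'M[F]_(r, r + e)) :
  row_free A -> exists2 Q, Q \in unitmx & A = row_mx 1%:M 0 *m Q.
Proof.
move=> Af; pose I0 := row_mx 1%:M 0 : 'M[F]_(r, r + e).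
have /eqmxMunitP[P Pu E] : (A^T == I0^T)%MS.
  apply/andP; split; apply: submx_full; rewrite /row_full mxrank_tr //.
  by apply/row_freeP; exists (col_mx 1%:M 0); rewrite mul_row_col mul1mx mul0mx addr0.
exists P^T; first by rewrite unitmx_tr.
by apply: trmx_inj; rewrite trmx_mul trmxK.
Qed.

(** Normalise [R1] and [R2] to [row_mx 1 0] by changes of basis [Q1], [Q2]. The common product is
    then the top block [X] of both [Q1 *m C1] and [Q2 *m C2], and a block lower triangular matrix
    fixing [X] remains to be found. *)
Lemma rank_factor_pair (n r : nat) (C1 C2 : 'M[F]_(n, r)) (R1 R2 : 'M[F]_(r, n)) :
  row_full C1 -> row_full C2 -> row_free R1 -> row_free R2 ->
  R1 *m C1 = R2 *m C2 ->
  exists P, [/\ P \in unitmx, P *m C1 = C2 & R2 *m P = R1].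
Proof.
move=> C1f C2f R1f R2f E.
have [e En] : exists e, n = (r + e)%N.
  by exists (n - r)%N; rewrite subnKC // -(eqP R1f) rank_leq_col.
subst n.
have [Q1 Q1u R1E] := row_free_factor R1f; have [Q2 Q2u R2E] := row_free_factor R2f.
have full (Q : 'M[F]_(r + e)) (C : 'M_(_, r)) :
    Q \in unitmx -> row_full C -> row_full (Q *m C).
  by move=> Qu Cf; rewrite (eq_row_full (eqmxMfull _ _)) // row_full_unit.
pose X := usubmx (Q1 *m C1); pose Y1 := dsubmx (Q1 *m C1); pose Y2 := dsubmx (Q2 *m C2).
have E1 : Q1 *m C1 = col_mx X Y1 by rewrite vsubmxK.
have E2 : Q2 *m C2 = col_mx X Y2.
  rewrite -[LHS]vsubmxK; congr col_mx.
  move: E; rewrite R1E R2E -!mulmxA -[Q1 *m C1]vsubmxK -[Q2 *m C2]vsubmxK.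
  by rewrite !mul_row_col !mul0mx !mul1mx !addr0 col_mxKu => <-.
(* Right multiplication by [cokermx X] is the quotient by the row space of [X]. There [Y1] and [Y2]
   both span everything, so an invertible [T] relates them, and [S] corrects the difference by rows
   of [X]. *)
have kerE (Y : 'M_(e, r)) : row_full (col_mx X Y) -> (Y *m cokermx X :=: cokermx X)%MS.
  move=> Ff; have := eqmxMfull (cokermx X) Ff.
  rewrite mul_col_mx mulmx_coker; apply: eqmx_trans.
  by apply: eqmx_trans (addsmxE _ _); apply: eqmx_sym; apply: adds0mx.
have k1 : (Y1 *m cokermx X :=: cokermx X)%MS by apply: kerE; rewrite -E1 full.
have k2 : (Y2 *m cokermx X :=: cokermx X)%MS by apply: kerE; rewrite -E2 full.
have /eqmxMunitP[T Tu ET] : (Y2 *m cokermx X == Y1 *m cokermx X)%MS.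
  by apply/eqmxP; apply: eqmx_trans k2 (eqmx_sym k1).
have /submxP[S ES] : (Y2 - T *m Y1 <= X)%MS.
  by rewrite submxE mulmxBl ET mulmxA subrr.
pose P : 'M_(r + e) := block_mx 1%:M 0 S T.
have Pu : P \in unitmx by rewrite unitmxE det_lblock det1 mul1r -unitmxE.
exists (invmx Q2 *m P *m Q1); split.
- by rewrite !unitmx_mul unitmx_inv Q2u Pu.
- rewrite -!mulmxA E1 mul_block_col mul1mx mul0mx addr0 -ES subrK -E2.
  by rewrite mulKmx.
- rewrite R2E !mulmxA mulmxK // mul_row_block !mul1mx !mul0mx !addr0.
  by rewrite -R1E.
Qed.

Lemma full_rank_factor (n r : nat) (N : 'M[F]_n) : \rank N = r ->
  exists (C : 'M[F]_(n, r)) (R : 'M[F]_(r, n)),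
    [/\ row_full C, row_free R & C *m R = N].
Proof.
move=> <-; exists (col_base N), (row_base N).
by rewrite col_base_full row_base_free mulmx_base.
Qed.

Lemma mulmx_swap_exp (n r : nat) (C : 'M[F]_(n, r)) (R : 'M[F]_(r, n)) k :
  (C *m R) ^+ k.+1 = C *m (R *m C) ^+ k *m R.
Proof.
elim: k => [|k IH]; first by rewrite expr1 mulmx1.
by rewrite exprSr IH -[_ * _]/(_ *m _) exprSr -[_ ^+ k * _]/(_ *m _) !mulmxA.
Qed.

(* Writing N = C R with C, R of full rank turns the powers of N into those of the
   smaller matrix R C, whose ranks are those of N shifted by one. *)
Lemma nilpotent_similar_eqdim (n : nat) (N1 N2 : 'M[F]_n) :
  (exists k, N1 ^+ k = 0) -> (forall k, \rank (N1 ^+ k) = \rank (N2 ^+ k)) ->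
  exists2 P, P \in unitmx & P *m N1 = N2 *m P.
Proof.
elim/ltn_ind: n => n IH in N1 N2 *; case: n => [|n] in IH N1 N2 *.
  by move=> _ _; exists 1%:M; rewrite ?unitmx1 // [LHS]flatmx0 [RHS]flatmx0.
move=> [k Nk] rE; set r := \rank N1.
have r_lt : (r < n.+1)%N.
  rewrite ltn_neqAle rank_leq_row andbT; apply/negP => rn.
  have : N1 \in unitmx by rewrite -row_free_unit.
  move=> /(unitrX k).
  by rewrite Nk unitr0.
have [|C1 [R1 [C1f R1f E1]]] := @full_rank_factor _ r N1; first by [].
have [|C2 [R2 [C2f R2f E2]]] := @full_rank_factor _ r N2.
  by have := rE 1%N; rewrite !expr1.
have shift (C : 'M[F]_(n.+1, r)) (R : 'M_(r, n.+1)) j : row_full C -> row_free R ->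
    \rank ((R *m C) ^+ j) = \rank ((C *m R) ^+ j.+1).
  by move=> Cf Rf; rewrite mulmx_swap_exp mxrankMfree // (eqmxMfull _ Cf).
have [||Q Qu EQ] := IH r r_lt (R1 *m C1) (R2 *m C2).
- exists k; apply/eqP; rewrite -mxrank_eq0 shift // E1.
  by rewrite exprS Nk mulr0 mxrank0.
- by move=> j; rewrite !shift // E1 E2 rE.
have [|||||P [Pu EC ER]] := @rank_factor_pair _ _ (C1 *m invmx Q) C2 (Q *m R1) R2.
- by rewrite /row_full mxrankMfree // row_free_unit unitmx_inv.
- exact: C2f.
- by rewrite /row_free (eqmxMfull _ _) // row_full_unit.
- exact: R2f.
- by rewrite mulmxA -(mulmxA Q) EQ mulmxK.
exists P => //.
have -> : N1 = (C1 *m invmx Q) *m (Q *m R1) by rewrite mulmxA mulmxKV.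
by rewrite mulmxA EC -E2 -mulmxA ER.
Qed.

Lemma nilpotent_similar (n1 n2 : nat) (N1 : 'M[F]_n1) (N2 : 'M[F]_n2) :
  (exists k, N1 ^+ k = 0) -> (forall k, \rank (N1 ^+ k) = \rank (N2 ^+ k)) ->
  exists (P : 'M[F]_(n2, n1)) (P' : 'M[F]_(n1, n2)),
    [/\ P *m P' = 1%:M, P' *m P = 1%:M & P *m N1 = N2 *m P].
Proof.
move=> Nk rE; have En : n1 = n2 by have := rE 0%N; rewrite !expr0 !mxrank1.
subst n2; have [P Pu E] := nilpotent_similar_eqdim Nk rE.
by exists P, (invmx P); rewrite mulmxV // mulVmx.
Qed.

End Similarity.

(** * Isomorphisms of almost abelian algebras *)

Section LieAlgebras.
Variable F : fieldType.

(** Brackets have no e_0 component and the ideal is abelian, so each further bracket amounts to one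
    application of [M], realised by bracketing with e_0 = [(1, 0)]. The transposes express column
    spaces through row spaces. *)
Lemma lcs_almost_abelian (d : nat) (M : 'M[F]_d) (k : nat) (z : 'g_M) :
  lcs k.+1 z <-> z.1 = 0 /\ (z.2^T <= (M ^+ k.+1)^T)%MS.
Proof.
elim: k z => [|k IH] z; split.
- case=> N [c [x [y [_ ->]]]].
  elim/big_ind: _ => [|u v [u1 u2] [v1 v2]|i _].
  + by rewrite trmx0 sub0mx.
  + by rewrite /= u1 v1 addr0 linearD addmx_sub.
  + rewrite /= scaler0; split=> //.
    rewrite expr1 linearZ linearB !linearZ /= !trmx_mul.
    by rewrite scalemx_sub // addmx_sub // scalemx_sub ?eqmx_opp ?submxMl.
- case: z => a v /= [-> /submxP[D E]].
  exists 1%N, (fun=> 1), (fun=> (1, 0)), (fun=> (0, D^T)); split=> //.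
  rewrite big_ord1 scale1r; congr pair => /=.
  by rewrite scale1r scale0r subr0 -[v]trmxK E trmx_mul trmxK expr1.
- case=> N [c [x [y [yk ->]]]].
  elim/big_ind: _ => [|u v [u1 u2] [v1 v2]|i _].
  + by rewrite trmx0 sub0mx.
  + by rewrite /= u1 v1 addr0 linearD addmx_sub.
  + have [yi1 /submxP[D E]] := (IH _).1 (yk i).
    rewrite /= scaler0 yi1 scale0r subr0; split=> //.
    rewrite !linearZ /= trmx_mul E -mulmxA -trmx_mul.
    by rewrite -[M *m _]/(M * _) -exprS !scalemx_sub ?submxMl.
- case: z => a v /= [-> /submxP[D E]].
  exists 1%N, (fun=> 1), (fun=> (1, 0)), (fun=> (0, M ^+ k.+1 *m D^T)); split.
    by move=> _; apply/IH; rewrite trmx_mul trmxK submxMl.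
  rewrite big_ord1 scale1r; congr pair => /=.
  by rewrite scale1r scale0r subr0 -[v]trmxK E trmx_mul trmxK mulmxA exprS.
Qed.

Lemma lcs_isom (L L' : lieType F) (f : {linear L -> L'}) :
  (forall x y, f (bracket x y) = bracket (f x) (f y)) ->
  forall k z, lcs k z -> lcs k (f z).
Proof.
move=> fb; elim=> [//|k IH] z [N [c [x [y [yk ->]]]]].
exists N, c, (f \o x), (f \o y); split=> [i|]; first exact: IH (yk i).
by rewrite linear_sum; apply: eq_bigr => i _; rewrite linearZ fb.
Qed.

Lemma lie_isom_sym (L L' : lieType F) : lie_isom L L' -> lie_isom L' L.
Proof.
case=> f [[g fK gK] fb].
have g_lin : linear g.
  by move=> a x y; apply: (can_inj fK); rewrite linearP !gK.
pose G := GRing.isLinear.Build _ _ _ _ g g_lin.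
pose h : {linear L' -> L} := HB.pack g G.
exists h; split; first by exists f.
by move=> x y; apply: (can_inj fK); rewrite gK fb !gK.
Qed.

Lemma lie_isom_rank (d d' : nat) (M : 'M[F]_d) (M' : 'M[F]_d') (k : nat) :
  lie_isom ('g_ M) ('g_ M') -> (0 < k)%N -> \rank (M ^+ k) = \rank (M' ^+ k).
Proof.
case: k => // k iso _.
wlog suff: d d' M M' iso / (\rank (M ^+ k.+1) <= \rank (M' ^+ k.+1))%N.
  move=> le; apply/eqP; rewrite eqn_leq !le //.
  exact: lie_isom_sym.
case: iso => f [fbij fb].
pose g (u : 'rV[F]_d) : 'rV[F]_d' := (f ((0, u^T) : 'g_ M)).2^T.
(* An isomorphism need not preserve the abelian ideal, so [g] keeps only the vector component. On
   the image of [M ^+ k.+1] the e_0 component of [f] vanishes, which makes [g] injective there. *)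
have g_lin : linear g.
  move=> a u v; rewrite /g linearP.
  have -> : ((0, a *: u^T + v^T) : 'g_ M) = a *: ((0, u^T) : 'g_ M) + (0, v^T).
    by congr pair; rewrite /= scaler0 addr0.
  by rewrite linearP /= linearP.
pose G := GRing.isLinear.Build _ _ _ _ g g_lin.
pose h : {linear 'rV[F]_d -> 'rV[F]_d'} := HB.pack g G.
have hE u : u *m lin1_mx h = g u by rewrite mul_rV_lin1.
have sub u : (u <= (M ^+ k.+1)^T)%MS ->
    (f ((0, u^T) : 'g_ M)).1 = 0 /\ (g u <= (M' ^+ k.+1)^T)%MS.
  move=> uM; apply/lcs_almost_abelian/lcs_isom => //.
  by apply/lcs_almost_abelian; rewrite /= trmxK.
rewrite -mxrank_tr -(mxrank_tr (M' ^+ _)).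
have <- : \rank ((M ^+ k.+1)^T *m lin1_mx h) = \rank (M ^+ k.+1)^T.
  apply/mxrank_injP/rowV0P => u.
  rewrite sub_capmx => /andP[uM /sub_kermxP]; rewrite hE => gu0.
  have [f1 _] := sub u uM.
  have fu : f ((0, u^T) : 'g_ M) = 0.
    by apply: injective_projections; rewrite // -[LHS]trmxK -/(g u) gu0 trmx0.
  have [g' fK _] := fbij.
  have /(congr1 snd) /= : ((0, u^T) : 'g_ M) = 0.
    by apply: (can_inj fK); rewrite fu linear0.
  by move/(congr1 trmx); rewrite trmxK trmx0.
apply: mxrankS; apply/row_subP => i.
by rewrite row_mul hE; apply: (sub _ _).2; apply: row_sub.
Qed.

Lemma lie_isom_conj (d d' : nat) (M : 'M[F]_d) (M' : 'M[F]_d')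
    (P : 'M[F]_(d', d)) (P' : 'M[F]_(d, d')) :
  P *m P' = 1%:M -> P' *m P = 1%:M -> P *m M = M' *m P ->
  lie_isom ('g_ M) ('g_ M').
Proof.
move=> PP' P'P E.
pose f (x : 'g_ M) : 'g_ M' := (x.1, P *m x.2).
have f_lin : linear f.
  by move=> a x y; congr pair; rewrite /= mulmxDr scalemxAr.
pose G := GRing.isLinear.Build _ _ _ _ f f_lin.
pose h : {linear 'g_ M -> 'g_ M'} := HB.pack f G.
exists h; split.
  exists (fun x : 'g_ M' => ((x.1, P' *m x.2) : 'g_ M)) => -[a v];
    by congr pair; rewrite /= mulmxA ?PP' ?P'P mul1mx.
move=> x y; congr pair => /=.
by rewrite mulmxBr -!scalemxAr !mulmxA E.
Qed.

(* For k > 0 the value f k is the dimension of the k-th term of the lower central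
   series, and f 0 is the dimension of the abelian ideal. *)
Definition almost_abelian_ranks (L : lieType F) (f : nat -> nat) : Prop :=
  exists (d : nat) (M : 'M[F]_d), L = 'g_ M /\ forall k, \rank (M ^+ k) = f k.

Lemma almost_abelian_ranks_isom (L L' : lieType F) (f f' : nat -> nat) :
  almost_abelian_ranks L f -> almost_abelian_ranks L' f' ->
  (exists k, f k = 0%N) -> f =1 f' -> lie_isom L L'.
Proof.
case=> d [M [-> Mf]] [d' [M' [-> Mf']]] [k fk] ff'.
have [||P [P' [PP' P'P E]]] := @nilpotent_similar _ _ _ M M'.
- by exists k; apply/eqP; rewrite -mxrank_eq0 Mf fk.
- by move=> j; rewrite Mf Mf' ff'.
exact: lie_isom_conj PP' P'P E.
Qed.

Lemma isom_almost_abelian_ranks (L L' : lieType F) (f f' : nat -> nat) (k : nat) :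
  almost_abelian_ranks L f -> almost_abelian_ranks L' f' -> lie_isom L L' ->
  (0 < k)%N -> f k = f' k.
Proof.
case=> d [M [-> Mf]] [d' [M' [-> Mf']]] iso k0.
by rewrite -Mf -Mf'; apply: lie_isom_rank.
Qed.

Lemma step_nilpotent_ranks (L : lieType F) (f : nat -> nat) (k : nat) :
  almost_abelian_ranks L f -> (0 < k)%N ->
  (forall j, (0 < j)%N -> (f j == 0%N) = (k <= j)%N) -> step_nilpotent L k.
Proof.
case=> d [M [-> Mf]]; case: k => // k _ fP; split=> [|j jk].
  case=> a v /lcs_almost_abelian/= [->].
  have /eqP := Mf k.+1; rewrite (eqP (_ : f k.+1 == 0%N)) ?fP // mxrank_eq0.
  by move=> /eqP ->; rewrite trmx0 submx0 trmx_eq0 => /eqP ->.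
move=> triv; case: j jk triv => [_ triv|j jk triv].
  (* The term of index 0 is the whole algebra, which contains e_0 whatever the ranks are. *)
  have /(congr1 fst)/eqP := triv (1, 0) I.
  by rewrite oner_eq0.
suff /eqP : f j.+1 = 0%N by rewrite fP // leqNgt jk.
rewrite -Mf -mxrank_tr; apply/eqP; rewrite mxrank_eq0 -submx0.
apply/row_subP => i; have : lcs j.+1 ((0, (row i (M ^+ j.+1)^T)^T) : 'g_ M).
  by apply/lcs_almost_abelian; rewrite /= trmxK row_sub.
by move=> /triv/(congr1 snd)/(congr1 trmx) /=; rewrite trmxK trmx0 => ->; rewrite sub0mx.
Qed.

End LieAlgebras.

(** * Ranks of the canonical matrices *)

Section ShiftMatrices.
Variable F : fieldType.

(** This sends e_j to e_(j+c), or to 0 past the end. With c = 4 it covers [bigJ] and the extended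
    blocks, with c = 1 it is [nilJ]. *)
Definition shift_mx (c n : nat) : 'M[F]_n := \matrix_(i, j) (i == j + c :> nat)%N%:R.

Lemma shift_mx_exp c n k : shift_mx c n ^+ k = shift_mx (c * k) n.
Proof.
elim: k => [|k IH].
  by apply/matrixP => i j; rewrite !mxE muln0 addn0.
rewrite exprS IH; apply/matrixP => i j; rewrite !mxE.
have [jlt|jge] := ltnP (j + c * k) n; last first.
  rewrite big1 => [|l _].
    by rewrite (_ : _ == _ = false) //; apply/negbTE; have := ltn_ord i; lia.
  rewrite !mxE [(l == _ :> nat)](_ : _ = false) ?mulr0 //; apply/negbTE.
  by have := ltn_ord l; lia.
rewrite (bigD1 (Ordinal jlt)) //= big1 => [|l /negbTE lj]; last first.
  by rewrite !mxE -[l == (_ + _)%N :> nat]/(l == Ordinal jlt) lj mulr0.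
by rewrite addr0 !mxE eqxx mulr1 mulnS addnAC addnA.
Qed.

Lemma rank_shift_mx c n : \rank (shift_mx c n) = (n - c)%N.
Proof.
have [nc|/ltnW cn] := leqP n c.
  rewrite (_ : shift_mx c n = 0) ?mxrank0; first by lia.
  apply/matrixP => i j; rewrite !mxE (_ : _ == _ = false) //.
  by apply/negbTE; have := ltn_ord i; lia.
have [e En] : exists e, n = (c + e)%N by exists (n - c)%N; lia.
subst n; rewrite addKn.
(* The identity block of size e sits in the lower left corner: rows split as c + e but columns as e
   + c, hence the cast. *)
have -> : shift_mx c (c + e) =
    castmx (erefl, addnC e c) (block_mx 0 0 1%:M 0 : 'M_(c + e, e + c)).
  apply/matrixP => i j; rewrite castmxE cast_ord_id !mxE.
  case: splitP => i' Ei; rewrite !mxE; case: splitP => j' /= Ej; rewrite !mxE //.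
  - by rewrite (_ : _ == _ = false) //; apply/negbTE; have := ltn_ord i'; lia.
  - by rewrite (_ : _ == _ = false) //; apply/negbTE; have := ltn_ord i'; lia.
  - by congr (_%:R); rewrite -val_eqE /= Ei Ej; apply/eqP/eqP; lia.
  - by rewrite (_ : _ == _ = false) //; apply/negbTE; have := ltn_ord i'; lia.
have cast_rank m1 n1 n2 (A : 'M[F]_(m1, n1)) (e12 : n1 = n2) :
    \rank (castmx (erefl, e12) A) = \rank A by subst n2; rewrite castmx_id.
by rewrite cast_rank /block_mx row_mx0 rank_col_0mx rank_row_mx0 mxrank1.
Qed.

Lemma rank_shift_mx_exp c n k : \rank (shift_mx c n ^+ k) = (n - c * k)%N.
Proof. by rewrite shift_mx_exp rank_shift_mx. Qed.

Lemma rank_exp0 n k : \rank ((0 : 'M[F]_n) ^+ k) = (if k == 0 then n else 0)%N.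
Proof. by case: k => [|k]; rewrite ?expr0 ?mxrank1 // exprS mul0r mxrank0. Qed.

Lemma dsum_exp a b (A : 'M[F]_a) (B : 'M[F]_b) k :
  dsum A B ^+ k = dsum (A ^+ k) (B ^+ k).
Proof.
elim: k => [|k IH]; first by rewrite !expr0 /dsum -scalar_mx_block.
rewrite !exprS IH -[LHS]/(_ *m _) /dsum mulmx_block.
by rewrite !mulmx0 !mul0mx !addr0 add0r.
Qed.

Lemma rank_dsum_exp a b (A : 'M[F]_a) (B : 'M[F]_b) k :
  \rank (dsum A B ^+ k) = (\rank (A ^+ k) + \rank (B ^+ k))%N.
Proof. by rewrite dsum_exp rank_diag_block_mx. Qed.

Lemma mxdiag_exp n (d : 'I_n -> nat) (D : forall i, 'M[F]_(d i)) k :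
  (\mxdiag_i D i) ^+ k = \mxdiag_i (D i ^+ k).
Proof.
elim: k => [|k IH]; first by rewrite expr0 -[1]mxdiagZ.
rewrite exprS IH -[LHS]/(_ *m _) {1}/mxdiag mul_mxblock_mxdiag /mxdiag.
apply/eq_mxblock => i j; case: eqVneq => [->|_]; last by rewrite mul0mx.
by rewrite !conform_mx_id exprS.
Qed.

Lemma rank_mxdiag_exp n (d : 'I_n -> nat) (D : forall i, 'M[F]_(d i)) k :
  \rank ((\mxdiag_i D i) ^+ k) = (\sum_i \rank (D i ^+ k))%N.
Proof. by rewrite mxdiag_exp rank_mxdiag. Qed.

Lemma rank_dpow_exp a (A : 'M[F]_a) p k :
  \rank (dpow A p ^+ k) = (p * \rank (A ^+ k))%N.
Proof. by rewrite rank_mxdiag_exp sum_nat_const card_ord. Qed.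

End ShiftMatrices.

(** Division with remainder by the block size: it turns entries of block matrices into arithmetic on
    flat indices. *)
Lemma tagnat_const_val (n c : nat) (s : 'I_(\sum_(i < n) c)) :
  s = (tagnat.sig1 s * c + tagnat.sig2 s)%N :> nat.
Proof.
rewrite {1}tagnat.rect -(big_ord_widen _ (fun=> c)) ?sum_nat_const ?card_ord //.
exact/ltnW/ltn_ord.
Qed.

Section CanonicalMatrices.
Variable F : fieldType.

Lemma bigJ_shift m : bigJ F m = shift_mx F 4 (\sum_(i < m) 4)%N.
Proof.
apply/matrixP => s t; rewrite !mxE.
have := tagnat_const_val s; have := tagnat_const_val t.
move: (tagnat.sig1 s) (tagnat.sig1 t) (tagnat.sig2 s) (tagnat.sig2 t) => i j a b.
move=> Et Es; rewrite Et Es.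
have := ltn_ord a; have := ltn_ord b => b4 a4.
case: eqP => [ij|ij]; rewrite mxE; last by rewrite (_ : _ == _ = false) //; apply/eqP; lia.
by congr (_%:R); rewrite -val_eqE /=; apply/eqP/eqP; lia.
Qed.

Lemma topU_shift m : topU F m = \matrix_(i, j) (i == j.+1 :> nat)%N%:R.
Proof.
apply/matrixP => s j; rewrite !mxE.
have := tagnat_const_val s.
move: (tagnat.sig1 s) (tagnat.sig2 s) => i a Es; rewrite Es.
have := ltn_ord a; have := ltn_ord j => j3 a4.
case: eqP => [ij|ij]; rewrite mxE; last by rewrite (_ : _ == _ = false) //; apply/eqP; lia.
by congr (_%:R); congr nat_of_bool; apply/eqP/eqP; lia.
Qed.

(** [U] sends the extra coordinate j < 3 to position j + 1 of the first block, which is coordinate 3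
    + (j + 1) = j + 4 overall. *)
Lemma chain_block_shift m : (0 < m)%N ->
  block_mx (0 : 'M[F]_3) 0 (topU F m) (bigJ F m) = shift_mx F 4 (3 + \sum_(i < m) 4)%N.
Proof.
move=> m0; rewrite bigJ_shift topU_shift; apply/matrixP => i j.
rewrite !mxE; case: splitP => i' Ei; rewrite !mxE; case: splitP => j' Ej; rewrite !mxE Ei Ej.
- by rewrite (_ : _ == _ = false) //; apply/eqP; have := ltn_ord i'; lia.
- by rewrite (_ : _ == _ = false) //; apply/eqP; have := ltn_ord i'; lia.
- by congr (_%:R); congr nat_of_bool; apply/eqP/eqP; lia.
- by congr (_%:R); congr nat_of_bool; apply/eqP/eqP; lia.
Qed.

Lemma sum_four m : (\sum_(i < m) 4)%N = (4 * m)%N.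
Proof. by rewrite sum_nat_const card_ord mulnC. Qed.

Lemma rank_bigJ_exp m k : \rank (bigJ F m ^+ k) = (4 * m - 4 * k)%N.
Proof. by rewrite bigJ_shift rank_shift_mx_exp sum_four. Qed.

Lemma rank_matN_exp m p k : (0 < m)%N -> (0 < p)%N ->
  \rank (matN F m p ^+ k) = (p * (4 * m - 4 * k) + 3 * (k <= m))%N.
Proof.
move=> m0 p0; rewrite /matN rank_dsum_exp rank_dpow_exp rank_bigJ_exp.
rewrite chain_block_shift // rank_shift_mx_exp sum_four.
case: p p0 => // p _; rewrite mulSn addnAC; congr addn.
(* The truncated difference 3 + 4m - 4k drops from 3 at k = m straight to 0 at k = m + 1. *)
by case: leqP; lia.
Qed.

Lemma rank_matNs_exp s k : (0 < s)%N ->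
  \rank (matNs F s ^+ k) = ((k == 0) * (4 * s) + 3 * (k <= 1))%N.
Proof.
move=> s0; rewrite /matNs; set N := block_mx _ _ _ _.
case: k => [|[|k]].
- by rewrite expr0 mxrank1 sum_four; lia.
- rewrite expr1 /N /block_mx row_mx0 rank_col_0mx rank_row_mx0.
  apply/eqP/row_fullP.
  (* The transpose of [topU] is a left inverse of it. *)
  exists (\matrix_(i, j) (j == i.+1 :> nat)%N%:R); rewrite topU_shift.
  apply/matrixP => i l; rewrite !mxE.
  have i_lt : (i.+1 < \sum_(i < s) 4)%N by rewrite sum_four; have := ltn_ord i; lia.
  move: (\sum_(i < s) 4)%N i_lt => n i_lt.
  rewrite (bigD1 (Ordinal i_lt)) //= big1 => [|j /negbTE ji]; last first.
    by rewrite !mxE -[j == i.+1 :> nat]/(j == Ordinal i_lt) ji mul0r.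
  by rewrite !mxE eqxx mul1r addr0 eqSS.
- rewrite (_ : _ ^+ _ = 0) ?mxrank0 // !exprS mulrA.
  rewrite (_ : N * N = 0) ?mul0r // -[LHS]/(_ *m _) mulmx_block.
  by rewrite !mulmx0 !mul0mx !addr0 -block_mx0.
Qed.

(* [jordan_ranks r m p s k] is the real rank of the k-th power of a quaternionic
   matrix with Jordan type (r, m, p, s). *)
Definition jordan_ranks (r : nat) (m p : nat -> nat) (s k : nat) : nat :=
  (\sum_(1 <= i < r.+1) p i * (4 * m i - 4 * k) + (k == 0) * (4 * s))%N.

Lemma rank_Jsum_exp (m p : nat -> nat) a b k :
  \rank (Jsum F m p a b ^+ k) = (\sum_(a <= i < b.+1) p i * (4 * m i - 4 * k))%N.
Proof.
rewrite rank_mxdiag_exp -[in RHS](add0n a) big_addn big_mkord.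
by apply: eq_bigr => i _; rewrite rank_dpow_exp rank_bigJ_exp addnC.
Qed.

(* The size of the Jordan block that the 3 extra coordinates extend in A_l; 0
   stands for no block, and A_(r+1) extends a block of size 1. *)
Definition chain_length (r : nat) (m : nat -> nat) (l : nat) : nat :=
  if l == 0%N then 0%N else if (l <= r)%N then m l else 1%N.

Lemma gA_ranks (q r : nat) (m p : nat -> nat) (s l : nat) :
  jordan_tuple q r m p s -> (l <= r + 1 - (s == 0%N))%N ->
  almost_abelian_ranks (gA F r m p s l)
    (fun k => jordan_ranks r m p s k + 3 * (k <= chain_length r m l))%N.
Proof.
move=> [r1 _ m2 p0 _] l_le; rewrite /gA /chain_length /jordan_ranks.
case: eqP => [_|l0]; first last; first case: leqP => lr.
- exists _, (matA_mid F r m p s l); split=> // k.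
  have /m2 ml : (1 <= l <= r)%N by lia.
  have /p0 pl : (1 <= l <= r)%N by lia.
  rewrite /matA_mid 3!rank_dsum_exp rank_exp0 !rank_Jsum_exp rank_matN_exp //; last by lia.
  (* Splitting the sum at l isolates the blocks of size [m l], one of which has been lengthened. *)
  rewrite (@big_cat_nat _ _ _ l 1 r.+1) /=; [|by lia..].
  rewrite (big_ltn (_ : (l < r.+1)%N)) // prednK; last by lia.
  by case: (k == 0%N); lia.
- have s0 : (0 < s)%N by case: s l_le => //=; lia.
  exists _, (matA_last F r m p s); split=> // k.
  by rewrite /matA_last rank_dsum_exp rank_Jsum_exp rank_matNs_exp // addnA.
- exists _, (matA0 F r m p s); split=> // k.
  rewrite /matA0 !rank_dsum_exp !rank_exp0 rank_Jsum_exp leqn0.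
  by case: (k == 0%N); lia.
Qed.

End CanonicalMatrices.

(** * Real form of quaternionic matrices *)

Section QuaternionicMatrices.
Variable F : fieldType.

(* The inverse of sigma, extended to rectangular matrices. *)
Definition realH (a b : nat) (M : 'M[quat F]_(a, b)) : 'M[F]_(hdim a, hdim b) :=
  let X := map_mx (@qre F) M in let Y := map_mx (@qi F) M in
  let Z := - map_mx (@qj F) M in let W := map_mx (@qk F) M in
  block_mx (block_mx X (- Y) Y X) (block_mx (- Z) (- W) W (- Z))
           (block_mx Z (- W) W Z) (block_mx X Y (- Y) X).

Lemma realH_sigmaH q (B : 'M[F]_(hdim q)) : in_glH B -> realH (sigmaH B) = B.
Proof.
case/in_glHP => [X [Y [Z [W ->]]]]; rewrite /realH /sigmaH.
rewrite !(block_mxKul, block_mxKdl).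
have E (f : quat F -> F) (g : 'M[F]_q) :
    (forall i j, f (Quat (X i j) (Y i j) (- Z i j) (W i j)) = g i j) ->
    map_mx f (\matrix_(i, j) Quat (X i j) (Y i j) (- Z i j) (W i j)) = g.
  by move=> fg; apply/matrixP => i j; rewrite !mxE fg.
rewrite (E (@qre F) X) // (E (@qi F) Y) // (E (@qj F) (- Z)) ?(E (@qk F) W) ?opprK // => i j.
by rewrite mxE.
Qed.

Lemma realH_mul a b c (M : 'M[quat F]_(a, b)) (N : 'M[quat F]_(b, c)) :
  realH (M *m N) = realH M *m realH N.
Proof.
have mapM (f : quat F -> F) : {morph f : x y / x + y} -> f 0 = 0 ->
    map_mx f (M *m N) = \matrix_(i, j) \sum_k f (M i k * N k j).
  by move=> fD f0; apply/matrixP => i j; rewrite !mxE (big_morph _ fD f0).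
rewrite /realH !mapM // !mulmx_block.
by congr block_mx; rewrite ?add_block_mx; congr block_mx;
  apply/matrixP => i j; rewrite !mxE -?sumrN -?big_split /=; apply: eq_bigr => k _;
  rewrite !mxE /=; ring.
Qed.

Lemma realH1 a : realH (1%:M : 'M[quat F]_a) = 1%:M.
Proof.
have E (f : quat F -> F) x : f 0 = 0 -> f 1 = x -> map_mx f (1%:M : 'M_a) = x%:M.
  by move=> f0 <-; apply/matrixP => i j; rewrite !mxE; case: (i == j).
rewrite /realH (E (@qre F) 1) // (E (@qi F) 0) // (E (@qj F) 0) // (E (@qk F) 0) // !raddf0.
by rewrite block_mx0 -!scalar_mx_block.
Qed.

Lemma realH_real a (X : 'M[F]_a) :
  realH (map_mx (fun x => Quat x 0 0 0) X) = dsum (dsum X X) (dsum X X).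
Proof.
have E (f : quat F -> F) (Y : 'M[F]_a) : (forall i j, f (Quat (X i j) 0 0 0) = Y i j) ->
    map_mx f (map_mx (fun x => Quat x 0 0 0) X) = Y.
  by move=> fY; apply/matrixP => i j; rewrite !mxE fY.
have E0 (f : quat F -> F) : (forall x, f (Quat x 0 0 0) = 0) ->
    map_mx f (map_mx (fun x => Quat x 0 0 0) X) = 0.
  by move=> f0; apply: E => i j; rewrite f0 mxE.
by rewrite /realH (E (@qre F) X) // !E0 // !oppr0 block_mx0.
Qed.

(** The quaternionic Jordan form has entries 0 and 1, so it comes from this matrix over [F]. Its
    real form is four copies of it, whence the factor 4 in [jordan_ranks]. *)
Definition jordan_real (r : nat) (m p : nat -> nat) (s : nat) :=
  dsum (\mxdiag_(k < r) dpow (nilJ F (m k.+1)) (p k.+1)) (0 : 'M[F]_s).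

Lemma map_mxdiag (S T : nmodType) (f : S -> T) n (d : 'I_n -> nat)
    (D : forall i, 'M[S]_(d i)) :
  f 0 = 0 -> map_mx f (\mxdiag_i D i) = \mxdiag_i (map_mx f (D i)).
Proof.
move=> f0; apply/matrixP => i j; rewrite !mxE; case: eqP => [_|_]; last by rewrite !mxE.
have -> : (0 : 'M[T]_(d (tagnat.sig1 i), d (tagnat.sig1 j))) = map_mx f 0.
  by apply/matrixP => k l; rewrite !mxE.
by rewrite -map_conform_mx mxE.
Qed.

Lemma jordanH_real r m p s :
  jordanH F r m p s = map_mx (fun x => Quat x 0 0 0) (jordan_real r m p s).
Proof.
rewrite /jordanH /jordan_real /dsum map_block_mx map_mxdiag //.
congr block_mx; try by apply/matrixP => i j; rewrite !mxE.
apply: eq_mxdiag => k; rewrite map_mxdiag //; apply: eq_mxdiag => l.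
by apply/matrixP => i j; rewrite !mxE; case: eqP.
Qed.

Lemma nilJ_shift n : nilJ F n = shift_mx F 1 n.
Proof. by apply/matrixP => i j; rewrite !mxE addn1. Qed.

Lemma rank_jordan_real_exp r m p s k :
  (4 * \rank (jordan_real r m p s ^+ k))%N = jordan_ranks r m p s k.
Proof.
rewrite rank_dsum_exp rank_exp0 rank_mxdiag_exp /jordan_ranks mulnDr big_distrr /=.
rewrite big_add1 big_mkord; congr addn; last by case: eqP; lia.
apply: eq_bigr => i _; rewrite rank_dpow_exp nilJ_shift rank_shift_mx_exp.
by rewrite mul1n mulnCA mulnBr.
Qed.

Lemma rank_conj_exp (a b : nat) (M : 'M[F]_a) (N : 'M[F]_b) (P : 'M_(a, b)) (P' : 'M_(b, a)) k :
  P *m P' = 1%:M -> P' *m P = 1%:M -> M = P *m N *m P' ->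
  \rank (M ^+ k) = \rank (N ^+ k).
Proof.
move=> PP' P'P E.
have Mk : M ^+ k = P *m N ^+ k *m P'.
  elim: k => [|k IH]; first by rewrite !expr0 mulmx1 PP'.
  rewrite exprS IH -[LHS]/(_ *m _) E exprS -[N * _]/(_ *m _) !mulmxA.
  by rewrite -(mulmxA _ P' P) P'P mulmx1.
have Nk : N ^+ k = P' *m M ^+ k *m P.
  by rewrite Mk !mulmxA P'P mul1mx -mulmxA P'P mulmx1.
apply/eqP; rewrite eqn_leq; apply/andP; split; [rewrite Mk | rewrite Nk];
  exact: leq_trans (mxrankM_maxl _ _) (mxrankM_maxr _ _).
Qed.

(** Being multiplicative and unital, [realH] carries the quaternionic conjugation to a real one,
    which preserves the ranks of powers. *)
Lemma is_Sigma_ranks q (B : 'M[F]_(hdim q)) r m p s k :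
  in_glH B -> is_Sigma B r m p s -> \rank (B ^+ k) = jordan_ranks r m p s k.
Proof.
move=> hB [_ [P [P' [PP' P'P E]]]].
rewrite -rank_jordan_real_exp.
rewrite (@rank_conj_exp _ _ B (realH (jordanH F r m p s)) (realH P) (realH P')).
- by rewrite jordanH_real realH_real !rank_dsum_exp; lia.
- by rewrite -realH_mul PP' realH1.
- by rewrite -realH_mul P'P realH1.
- by rewrite -!realH_mul -E realH_sigmaH.
Qed.

End QuaternionicMatrices.

(** * Ranks of the powers of A *)

Section HypercomplexRanks.
Variables (F : realFieldType) (q : nat).
Implicit Types (B C : 'M[F]_(hdim q)) (v w : 'cV[F]_(hdim q)).

Local Notation J1 := (hJ1 F q).
Local Notation J2 := (hJ2 F q).
Local Notation J3 := (hJ3 F q).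

Lemma hJ_rel : [/\ J1 *m J1 = - 1%:M, J2 *m J2 = - 1%:M & J2 *m J1 = - J3].
Proof.
pose E := (mulmx_block, mul0mx, mulmx0, mulNmx, mulmxN, mul1mx, mulmx1,
           addr0, add0r, oppr0, opprK, opp_block_mx).
split; rewrite /hJ3 /hJ1 /hJ2 ?(scalar_mx_block (q + q)) ?(scalar_mx_block q) !E;
  by [].
Qed.

Definition hJ_imag (x y z : F) : 'M[F]_(hdim q) := x *: J1 + y *: J2 + z *: J3.

(** The mixed terms cancel because distinct complex structures anticommute. *)
Lemma hJ_imag_sqr x y z :
  hJ_imag x y z *m hJ_imag x y z = - (x ^+ 2 + y ^+ 2 + z ^+ 2) *: 1%:M.
Proof.
have [e11 e22 e21] := hJ_rel.
have e12 : J1 *m J2 = J3 by [].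
have e13 : J1 *m J3 = - J2 by rewrite mulmxA e11 mulNmx mul1mx.
have e32 : J3 *m J2 = - J1 by rewrite -mulmxA e22 mulmxN mulmx1.
have e23 : J2 *m J3 = J1 by rewrite mulmxA e21 mulNmx e32 opprK.
have e31 : J3 *m J1 = J2 by rewrite -mulmxA e21 mulmxN e13 opprK.
have e33 : J3 *m J3 = - 1%:M by rewrite {1}/hJ3 -mulmxA e23 e11.
rewrite /hJ_imag !mulmxDl !mulmxDr -!scalemxAl -!scalemxAr.
rewrite e11 e12 e13 e21 e22 e23 e31 e32 e33.
move: J1 J2 J3 (1%:M) => A1 A2 A3 I.
by apply/matrixP => i j; rewrite !mxE; ring.
Qed.

(** This is the block V of A; the width is convertible to 3 and keeps the three columns accessible
    to the block lemmas. *)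
Definition hyper_cols v : 'M[F]_(hdim q, 1 + (1 + 1)) :=
  row_mx (J1 *m v) (row_mx (J2 *m v) (J3 *m v)).

Lemma in_glH_exp B k : in_glH B -> in_glH (B ^+ k).
Proof.
case=> b1 b2 b3.
have comm (J : 'M_(hdim q)) : B *m J = J *m B -> B ^+ k *m J = J *m B ^+ k.
  by move=> BJ; elim: k => [|k IH]; rewrite ?mulmx1 ?mul1mx // exprS -[B * _]/(B *m _)
    -mulmxA IH !mulmxA BJ.
by split; apply: comm.
Qed.

Lemma hyperA_exp B v k : in_glH B ->
  hyperA B v ^+ k.+1 =
    block_mx (0 : 'M_3) 0 (hyper_cols (B ^+ k *m v) : 'M_(_, 3)) (B ^+ k.+1).
Proof.
move=> hB.
have colsE : hyper_cols (B ^+ k *m v) = B ^+ k *m hyper_cols v.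
  have [b1 b2 b3] := in_glH_exp k hB.
  rewrite /hyper_cols !mul_mx_row.
  by congr row_mx; [rewrite mulmxA -b1 -mulmxA | congr row_mx;
    [rewrite mulmxA -b2 -mulmxA | rewrite mulmxA -b3 -mulmxA]].
rewrite {}colsE; elim: k => [|k IH]; first by rewrite !expr1 mul1mx.
rewrite exprS IH -[LHS]/(_ *m _) mulmx_block !mul0mx !mulmx0 !add0r.
by rewrite mulmxA -[B *m _]/(B * _) -!exprS.
Qed.

(* If w h lies in the H-subspace im C for some imaginary h <> 0, then so does
   w h^2 = - |h|^2 w, hence w itself. *)
Lemma rank_hyper_cols w C : in_glH C ->
  \rank (row_mx (hyper_cols w) C) = (\rank C + 3 * ~~ (w^T <= C^T)%MS)%N.
Proof.
case=> c1 c2 c3.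
have stable (J : 'M_(hdim q)) u : C *m J = J *m C -> (u^T <= C^T)%MS ->
    ((J *m u)^T <= C^T)%MS.
  move=> CJ /submxP[D uD]; rewrite trmx_mul uD -mulmxA -trmx_mul -CJ trmx_mul mulmxA.
  exact: submxMl.
rewrite -mxrank_tr tr_row_mx -(addsmxE _ _).1.
case: (boolP (w^T <= C^T)%MS) => [wC|wnC].
  have sub : ((hyper_cols w)^T <= C^T)%MS.
    by rewrite !tr_row_mx !col_mx_sub !stable.
  by rewrite muln0 addn0 (addsmx_idPr sub) mxrank_tr.
have cols0 (a : 'rV_(1 + (1 + 1))) : (a *m (hyper_cols w)^T <= C^T)%MS -> a = 0.
  have -> : a = row_mx (lsubmx a) (row_mx (lsubmx (rsubmx a)) (rsubmx (rsubmx a))).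
    by rewrite !hsubmxK.
  move: (lsubmx a) (lsubmx (rsubmx a)) (rsubmx (rsubmx a)) => x y z.
  rewrite [x]mx11_scalar [y]mx11_scalar [z]mx11_scalar.
  move: (x 0 0) (y 0 0) (z 0 0) => {}x {}y {}z.
  rewrite !tr_row_mx !mul_row_col !mul_scalar_mx.
  rewrite (_ : _ + _ = (hJ_imag x y z *m w)^T) => [JwC|]; last first.
    by rewrite !mulmxDl -!scalemxAl !linearD !linearZ /= addrA.
  have CJ : C *m hJ_imag x y z = hJ_imag x y z *m C.
    by rewrite !mulmxDl !mulmxDr -!scalemxAl -!scalemxAr c1 c2 c3.
  have := stable _ _ _ CJ JwC.
  rewrite mulmxA hJ_imag_sqr -scalemxAl mul1mx linearZ /= => nwC.
  have n0 : x ^+ 2 + y ^+ 2 + z ^+ 2 = 0.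
    apply: contraNeq wnC => n0; rewrite -(eqmx_scale _ (_ : - (x ^+ 2 + y ^+ 2 + z ^+ 2) != 0)) //.
    by rewrite oppr_eq0.
  (* In an ordered field a vanishing sum of squares has vanishing terms. *)
  move/eqP: n0; rewrite !paddr_eq0 ?addr_ge0 ?sqr_ge0 // !sqrf_eq0.
  by move=> /andP[/andP[/eqP -> /eqP ->] /eqP ->]; rewrite !raddf0 !row_mx0.
rewrite mxrank_disjoint_sum.
  rewrite addnC mxrank_tr; congr addn.
  suff /eqP -> : row_free (hyper_cols w)^T by [].
  rewrite -kermx_eq0; apply/eqP/row_matrixP => i.
  rewrite row0; apply: cols0.
  by rewrite -row_mul mulmx_ker row0 sub0mx.
apply/eqP/rowV0P => u; rewrite sub_capmx => /andP[/submxP[a ->] /cols0 ->].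
by rewrite mul0mx.
Qed.

Lemma hyperA_ranks B v : in_glH B -> (exists k, B ^+ k = 0) ->
  exists t, (forall k, \rank (hyperA B v ^+ k) = (\rank (B ^+ k) + 3 * (k <= t))%N) /\
    ((0 < t)%N -> (\rank (B ^+ t.-1) + \rank (B ^+ t.+1))%N <> (2 * \rank (B ^+ t))%N).
Proof.
move=> hB [K BK].
pose in_im k := ((B ^+ k *m v)^T <= (B ^+ k.+1)^T)%MS.
have in_imS k : in_im k -> in_im k.+1.
  rewrite /in_im => /submxP[D E].
  rewrite exprS -mulmxA trmx_mul E -mulmxA -trmx_mul.
  by rewrite -[B *m _]/(B * _) -exprS submxMl.
have ex_im : exists k, in_im k by exists K; rewrite /in_im BK mul0mx trmx0 sub0mx.
have [t t_im t_min] := ex_minnP ex_im; exists t; split.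
  case=> [|k]; first by rewrite !expr0 !mxrank1 muln1 addnC.
  rewrite hyperA_exp // /block_mx row_mx0 rank_col_0mx rank_hyper_cols; last exact: in_glH_exp.
  (* The power k + 1 gains 3 exactly when [in_im k] fails, that is when k < t, since [in_im]
     persists once it holds. *)
  congr (_ + 3 * nat_of_bool _)%N; rewrite -/(in_im k) ltnNge; congr (~~ _).
  apply/idP/idP => [/t_min //|/subnK <-].
  by elim: (k - t)%N => // j; rewrite addSn; apply: in_imS.
case: t => // t in t_im t_min * => _ /=; set K' := kermx B^T => E.
(* Each rank drop is the dimension of an intersection with ker B, so a zero second difference forces
   two nested intersections to coincide. *)
have kerE k : (\rank (B ^+ k.+1) + \rank ((B ^+ k)^T :&: K')%MS = \rank (B ^+ k))%N.
  have := mxrank_mul_ker (B ^+ k)^T B^T.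
  by rewrite -trmx_mul !mxrank_tr exprS.
have sub : (((B ^+ t.+1)^T :&: K') <= ((B ^+ t)^T :&: K'))%MS.
  by apply: capmxS => //; rewrite exprSr trmx_mul submxMl.
have sup : (((B ^+ t)^T :&: K') <= ((B ^+ t.+1)^T :&: K'))%MS.
  rewrite -(mxrank_leqif_sup sub).2; apply/eqP.
  by have := kerE t; have := kerE t.+1; lia.
have /submxP[D DE] := t_im.
suff : in_im t by move/t_min; rewrite ltnn.
(* This difference is killed by B, hence lies in im B^(t+1); then so does B^t v, against the
   minimality of t + 1. *)
have zK : ((B ^+ t *m v)^T - D *m (B ^+ t.+1)^T <= (B ^+ t)^T :&: K')%MS.
  rewrite sub_capmx; apply/andP; split.
    rewrite addmx_sub ?eqmx_opp //; first by rewrite trmx_mul submxMl.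
    by rewrite exprSr -[_ * B]/(_ *m B) trmx_mul mulmxA submxMl.
  apply/sub_kermxP; rewrite mulmxBl -mulmxA -!trmx_mul mulmxA.
  by rewrite -[B *m _ ^+ t]/(B * _) -[B *m _]/(B * _) -!exprS DE subrr.
have := submx_trans (submx_trans zK sup) (capmxSl _ _) => zB.
rewrite /in_im -[X in (X <= _)%MS](subrK (D *m (B ^+ t.+1)^T)).
by rewrite addmx_sub // submxMl.
Qed.

End HypercomplexRanks.

(** * Jordan tuples *)

Section JordanTuples.
Variables (q r : nat) (m p : nat -> nat) (s : nat).
Hypothesis tup : jordan_tuple q r m p s.

Lemma jordan_tuple_le1 i : (1 <= i <= r)%N -> (m i <= m 1)%N.
Proof.
case: tup => _ m_decr _ _ _ /andP[i1 ir].
case: i i1 ir => [|[|i]] // _ ir; exact/ltnW/m_decr.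
Qed.

Lemma jordan_ranks_eq0 k : (0 < k)%N -> (jordan_ranks r m p s k == 0%N) = (m 1 <= k)%N.
Proof.
case: (tup) => r1 _ _ p0 _; case: k => // k _; rewrite /jordan_ranks addn0.
have p1 : (0 < p 1)%N by apply: p0; rewrite r1.
apply/idP/idP => [|mk].
  by rewrite big_ltn // addn_eq0 muln_eq0 => /andP[/orP[]/eqP]; lia.
rewrite big_nat_cond big1 // => i; rewrite andbT ltnS => /jordan_tuple_le1 mi.
by rewrite (_ : _ - _ = 0)%N ?muln0 //; lia.
Qed.

(** The value is 0 at l = 0, strictly decreasing and at least 2 for 1 <= l <= r, and 1 at l = r +
    1. *)
Lemma chain_length_inj l l' :
  (l <= r + 1 - (s == 0%N))%N -> (l' <= r + 1 - (s == 0%N))%N ->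
  chain_length r m l = chain_length r m l' -> l = l'.
Proof.
case: tup => r1 m_decr m2 p0 _.
wlog ll' : l l' / (l <= l')%N.
  move=> wl; have [/wl //|/ltnW /wl {}wl] := leqP l l'.
  by move=> h h' e; rewrite (wl h' h (esym e)).
move=> lb l'b; rewrite /chain_length.
have [->|l0] := eqVneq l 0%N.
  have [->//|l'0] := eqVneq l' 0%N; case: leqP => // l'r.
  by have := m2 l'; lia.
have [l'0|l'0] := eqVneq l' 0%N; first by lia.
case: leqP => lr; case: leqP => l'r //; last 2 first.
- by lia.
- by lia.
- have [//|ltl] := eqVneq l l'; have := m_decr l l'; lia.
- by have := m2 l; lia.
Qed.

(* The second difference at t of the ranks of the powers of a matrix counts its
   Jordan blocks of size t. *)
Lemma chain_length_surj t :
  ((0 < t)%N -> (jordan_ranks r m p s t.-1 + jordan_ranks r m p s t.+1)%N <>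
                (2 * jordan_ranks r m p s t)%N) ->
  exists2 l, (l <= r + 1 - (s == 0%N))%N & chain_length r m l = t.
Proof.
case: t => [|t] /=; first by exists 0%N.
move=> /(_ isT) neq.
case: (boolP (has (fun i => m i == t.+1) (index_iota 1 r.+1))) => [/hasP[i]|none].
  rewrite mem_index_iota ltnS => /andP[i1 ir] /eqP mi.
  exists i; first by lia.
  by rewrite /chain_length ir; case: i i1 mi {ir}.
(* Blocks of size 1 are counted by s and correspond to l = r + 1. Otherwise every summand is affine
   in k on t, t + 1, t + 2, as no [m i] equals t + 1. *)
have [[t0 s0]|ts] : (t = 0 /\ s <> 0)%N \/ (t <> 0 \/ s = 0)%N by lia.
  exists r.+1; first by lia.
  by rewrite /chain_length /= ltnn t0.
case: neq; rewrite /jordan_ranks /= !mul0n !addn0 big_distrr /=.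
have -> : ((t == 0) * (4 * s) = 0)%N by case: ts => [|->]; lia.
rewrite addn0 -big_split; apply: eq_big_seq => i i_in /=.
have mi : m i <> t.+1 by move=> mi; case/hasP: none; exists i; rewrite ?mi.
have [lt|ge] := ltnP (m i) t.+1.
  have e c : (t <= c)%N -> (4 * m i - 4 * c = 0)%N by lia.
  by rewrite !e ?muln0 //; lia.
by rewrite -mulnDr mulnCA; congr muln; lia.
Qed.

End JordanTuples.

Lemma jump_position_inj (f : nat -> nat) (t t' : nat) :
  (forall k, (0 < k)%N -> (f k + 3 * (k <= t) = f k + 3 * (k <= t'))%N) -> t = t'.
Proof.
move=> tt'; have {}tt' k : (0 < k)%N -> (k <= t)%N = (k <= t')%N.
  by move=> /tt'; lia.
by have := tt' t; have := tt' t'; lia.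
Qed.

Theorem theorem4p5 (R : realType) (n : nat) (hn : (2 <= n)%N)
    (B : 'M[R]_(hdim n.-1)) (hB : in_glH B)
    (Bnilp : exists k : nat, B ^+ k = 0)
    (v0 : 'cV[R]_(hdim n.-1)) (hA : hyperA B v0 <> 0) :
  (* (i) *)
  (B = 0 ->
     step_nilpotent ('g_ (hyperA B v0)) 2 /\
     lie_isom ('g_ (hyperA B v0)) ('g_ (matNs R n.-1))) /\
  (* (ii) *)
  (B <> 0 ->
     forall (r : nat) (m p : nat -> nat) (s : nat), is_Sigma B r m p s ->
       (exists! l : nat, (l <= r + 1 - (s == 0%N))%N /\
          lie_isom ('g_ (hyperA B v0)) (gA R r m p s l)) /\
       step_nilpotent (gA R r m p s 1%N) (m 1%N + 1)%N /\
       (forall l : nat, (l <= r + 1 - (s == 0%N))%N -> l <> 1%N ->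
          step_nilpotent (gA R r m p s l) (m 1%N))) /\
  (* the canonical algebras are pairwise non-isomorphic *)
  (forall (r : nat) (m p : nat -> nat) (s : nat), jordan_tuple n.-1 r m p s ->
     (forall l : nat, (l <= r + 1 - (s == 0%N))%N ->
        ~ lie_isom ('g_ (matNs R n.-1)) (gA R r m p s l)) /\
     (forall l l' : nat, (l <= r + 1 - (s == 0%N))%N ->
        (l' <= r + 1 - (s == 0%N))%N -> l <> l' ->
        ~ lie_isom (gA R r m p s l) (gA R r m p s l'))).
Proof.
have n0 : (0 < n.-1)%N by lia.
have Ns_ranks : almost_abelian_ranks ('g_ (matNs R n.-1))
    (fun k => (k == 0) * (4 * n.-1) + 3 * (k <= 1))%N.
  by exists _, (matNs R n.-1); split=> // k; rewrite rank_matNs_exp.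
have [t [A_rank t_jump]] := hyperA_ranks v0 hB Bnilp.
have A_ranks : almost_abelian_ranks ('g_ (hyperA B v0))
    (fun k => \rank (B ^+ k) + 3 * (k <= t))%N by exists _, (hyperA B v0).
split; [|split].
- move=> B0; rewrite {B}B0 in hB Bnilp hA A_rank t_jump A_ranks *.
  (* For t = 0 the rank of A would be 0; for t >= 2 the second difference of the ranks of powers of
     0 vanishes at t. *)
  have t1 : t = 1%N.
    have t0 : t <> 0%N.
      move=> t0; apply: hA; apply/eqP; rewrite -mxrank_eq0.
      by have := A_rank 1%N; rewrite !expr1 mxrank0 t0 => ->.
    case: t t0 t_jump {A_rank A_ranks} => [|[|t]] // _ /(_ isT) [].
    by rewrite !rank_exp0.
  split.
    apply: (step_nilpotent_ranks A_ranks) => // j j0.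
    by rewrite rank_exp0 t1; case: j j0 => [|[|j]].
  apply: (almost_abelian_ranks_isom A_ranks Ns_ranks).
    by exists 2; rewrite rank_exp0 t1.
  by move=> [|k]; rewrite rank_exp0 t1 /=; lia.
- move=> _ r m p s hS; have tup := hS.1.
  have [r1 m_decr m2 p0 _] := tup.
  have B_rank k : \rank (B ^+ k) = jordan_ranks r m p s k by apply: is_Sigma_ranks hS.
  (* The Jordan part dies at [m 1] and the 3 extra dimensions one step after the chain length; only
     l = 1 makes the latter exceed [m 1]. *)
  have nil l : (l <= r + 1 - (s == 0%N))%N ->
      step_nilpotent (gA R r m p s l) (maxn (m 1%N) (chain_length r m l).+1).
    move=> lb; apply: (step_nilpotent_ranks (gA_ranks R tup lb)) => [|j j0].
      by lia.
    by rewrite addn_eq0 (jordan_ranks_eq0 tup) // geq_max muln_eq0 eqb0 -ltnNge.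
  have m1 : (2 <= m 1)%N by apply: m2.
  split; [|split].
  + have [|l lb lt] := @chain_length_surj r m p s t.
      by rewrite -!B_rank.
    have iso : lie_isom ('g_ (hyperA B v0)) (gA R r m p s l).
      apply: (almost_abelian_ranks_isom A_ranks (gA_ranks R tup lb)).
        exists (maxn (m 1%N) t.+1); rewrite B_rank.
        have /eqP -> : jordan_ranks r m p s (maxn (m 1%N) t.+1) == 0%N.
          by rewrite (jordan_ranks_eq0 tup) ?leq_maxl; lia.
        lia.
      by move=> k; rewrite B_rank lt.
    exists l; split=> // l' [l'b iso'].
    apply: (chain_length_inj tup lb l'b); rewrite lt.
    apply: (@jump_position_inj (jordan_ranks r m p s)) => k k0; rewrite -B_rank.
    by rewrite (isom_almost_abelian_ranks A_ranks (gA_ranks R tup l'b) iso') // B_rank.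
  + have -> : (m 1%N + 1 = maxn (m 1%N) (chain_length r m 1).+1)%N.
      by rewrite /chain_length /= r1; lia.
    by apply: nil; lia.
  + move=> l lb l1.
    have -> : m 1%N = maxn (m 1%N) (chain_length r m l).+1; last exact: nil.
    rewrite /chain_length; case: eqP => [_|l0]; first by lia.
    case: leqP => lr; last by lia.
    have := m_decr 1%N l; lia.
- move=> r m p s tup; split=> [l lb iso|l l' lb l'b ll' iso]; last first.
    apply/ll'/(chain_length_inj tup lb l'b).
    apply: (@jump_position_inj (jordan_ranks r m p s)) => k.
    exact: isom_almost_abelian_ranks (gA_ranks R tup lb) (gA_ranks R tup l'b) iso.
  (* The derived algebra of the first has dimension 3, while a block of size at least 2 contributes
     at least 4 to the other. *)
  have := isom_almost_abelian_ranks (k := 1) Ns_ranks (gA_ranks R tup lb) iso isT.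
  have [r1 _ m2 p0 _] := tup.
  have m1 : (2 <= m 1)%N by apply: m2.
  have p1 : (0 < p 1)%N by apply: p0; rewrite r1.
  rewrite /jordan_ranks big_ltn //= mul0n addn0; nia.
Qed.
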